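(* Let $p\in[0,1]$ and let $s\ge 1$ be an integer. Let $\mathbf{x}^\star\in\mathbb{C}^n$ be an $s$-sparse vector observed through $\mathbf{y}=\mathbf{A}\mathbf{x}^\star+\mathbf{e}$, where $\mathbf{e}\in\mathbb{C}^m$ and the measurement matrix $\mathbf{A}\in\mathbb{C}^{m\times n}$ satisfies RIP of order $3s$. To estimate $\mathbf{x}^\star$ via the $\ell_p$-PGD algorithm, an $\ell_p$-ball $\widehat{\mathcal{B}}=\mathcal{F}_p(\widehat{c})$ with $p$-radius $\widehat{c}$ is given as the feasible set for the algorithm, such that $\widehat{c}=(1-\varepsilon)^p\,\|\mathbf{x}^\star\|_p^p$ for some $\varepsilon\in[0,1)$ (when $p=0$ one takes $\varepsilon=0$, so $\widehat{c}=\|\mathbf{x}^\star\|_0$). Suppose that the step-sizes $\eta_k>0$ of the algorithm are chosen to obey $$\left|\frac{\eta_k(\alpha_{3s}+\beta_{3s})}{2}-1\right|\le\tau$$ for some $\tau\ge 0$. If $$(1+\tau)\rho_{3s}+\tau<\frac{1}{2\left(1+\sqrt{2}\,\xi(p)\right)^2},$$ then $\mathbf{x}^k$, the $k$-th iterate of the algorithm, obeys $$\|\mathbf{x}^k-\mathbf{x}^\star\|_2\le(2\gamma)^k\|\mathbf{x}^\star\|_2+\frac{2(1+\tau)}{1-2\gamma}\left(1+\xi(p)\right)\left(\varepsilon(1+\rho_{3s})\|\mathbf{x}^\star\|_2+\frac{2\sqrt{\alpha_{2s}}}{\alpha_{3s}+\beta_{3s}}\|\mathbf{e}\|_2\right)+\varepsilon\|\mathbf{x}^\star\|_2,$$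 where $$\gamma=\left((1+\tau)\rho_{3s}+\tau\right)\left(1+\sqrt{2}\,\xi(p)\right)^2 .$$
   Context: A vector is $r$-sparse if it has at most $r$ non-zero entries. For $p\in(0,1]$, $\|\mathbf{x}\|_p=\left(\sum_i|x_i|^p\right)^{1/p}$; $\|\mathbf{x}\|_0$ is the number of non-zero entries of $\mathbf{x}$, and for $p=0$ the symbol $\|\mathbf{x}\|_p^p$ means $\|\mathbf{x}\|_0$ (i.e. $0^0=0$ in the sum $\sum_i|x_i|^0$). For $c\ge 0$, $\mathcal{F}_p(c)=\{\mathbf{x}\in\mathbb{C}^n : \sum_{i=1}^n|x_i|^p\le c\}$ (the $\ell_p$-ball of $p$-radius $c$). RIP: $\mathbf{A}$ has RIP of order $r$ with restricted isometry constants $\alpha_r$ and $\beta_r$ if they are, in order, the smallest and the largest non-negative numbers such that $\beta_r\|\mathbf{x}\|_2^2\le\|\mathbf{A}\mathbf{x}\|_2^2\le\alpha_r\|\mathbf{x}\|_2^2$ for all $r$-sparse $\mathbf{x}$. Put $\rho_r=\frac{\alpha_r-\beta_r}{\alpha_r+\beta_r}$. $\xi(p)=\sqrt{p}\left(\frac{2}{2-p}\right)^{1/2-1/p}$ for $p\in(0,1]$, and $\xi(0)=0$. $\ell_p$-PGD (projected gradient descent): given a feasible set $\mathcal{Q}=\mathcal{F}_p(c)$, $\mathrm{P}_{\mathcal{Q}}(\mathbf{x})$ is a fixed choice of a minimizer of $\|\mathbf{x}-\mathbf{u}\|_2^2$ over $\mathbf{u}\in\mathcal{Q}$ (the minimizer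 need not be unique; any choice is acceptable). The algorithm chooses an initial point $\mathbf{x}^0\in\mathcal{Q}$ and computes the iterates $\mathbf{x}^{k+1}=\mathrm{P}_{\mathcal{Q}}\left(\mathbf{x}^k-\eta_k\mathbf{A}^{\mathsf H}(\mathbf{A}\mathbf{x}^k-\mathbf{y})\right)$, $k=0,1,2,\ldots$, where $\eta_k>0$ is the step-size and $\mathbf{A}^{\mathsf H}$ is the Hermitian conjugate of $\mathbf{A}$.
   Formalization: The initial point x^0 in the feasible set is also required to satisfy ||x^0 - x*||_2 <= ||x*||_2 (true for x^0 = 0); for an arbitrary feasible x^0 the bound fails, e.g. n=m=s=p=1, A=1, x*=1, x^0=-1, e=0, eps=0, tau=0, k=0. *)

(* Defs.v *)
From HB Require Import structures.
From mathcomp Require Import all_boot all_order all_algebra.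
From mathcomp Require Import complex.
From mathcomp Require Import classical_sets reals exp.

Set Implicit Arguments.
Unset Strict Implicit.
Unset Printing Implicit Defensive.

Import Order.TTheory GRing.Theory Num.Theory.
Import ComplexField.

Local Open Scope classical_set_scope.
Local Open Scope ring_scope.
Local Open Scope complex_scope.

Section PGD.
Context {R : realType}.

(* Real-valued moduli and norms: in [R[i]] the norm [`|z|] is itself an
   element of [R[i]], namely [(Normc.normc z)%:C]. *)
Definition modulus (z : R[i]) : R := Normc.normc z.

Definition l2norm n (x : 'cV[R[i]]_n) : R :=
  Num.sqrt (\sum_(i < n) modulus (x i 0) ^+ 2).

Definition l0norm n (x : 'cV[R[i]]_n) : nat := #|[set i | x i 0 != 0]%SET|.

Definition sparse n (r : nat) (x : 'cV[R[i]]_n) : Prop := (l0norm x <= r)%N.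

(* [||x||_p^p].  Zero entries are left out because [0 `^ 0 = 1] in the library,
   whereas the convention here is [0^0 = 0]; for [p > 0] this is immaterial. *)
Definition lpnorm_pow n (p : R) (x : 'cV[R[i]]_n) : R :=
  \sum_(i < n | x i 0 != 0) modulus (x i 0) `^ p.

Definition lpball n (p c : R) : set 'cV[R[i]]_n := [set x | lpnorm_pow p x <= c].

Definition rip_upper m n (A : 'M[R[i]]_(m, n)) (r : nat) : set R :=
  [set a | 0 <= a /\ forall x : 'cV[R[i]]_n, sparse r x ->
     l2norm (A *m x) ^+ 2 <= a * l2norm x ^+ 2].

Definition rip_lower m n (A : 'M[R[i]]_(m, n)) (r : nat) : set R :=
  [set b | 0 <= b /\ forall x : 'cV[R[i]]_n, sparse r x ->
     b * l2norm x ^+ 2 <= l2norm (A *m x) ^+ 2].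

(* The constants alpha_r and beta_r are given as relations ([alpha] is the
   smallest, [beta] the largest admissible number).  Both exist as soon as
   [0 < r] and [0 < n]. *)
Definition is_ric_upper m n (A : 'M[R[i]]_(m, n)) (r : nat) (alpha : R) : Prop :=
  rip_upper A r alpha /\ lbound (rip_upper A r) alpha.

Definition is_ric_lower m n (A : 'M[R[i]]_(m, n)) (r : nat) (beta : R) : Prop :=
  rip_lower A r beta /\ ubound (rip_lower A r) beta.

Definition ric_ratio (alpha beta : R) : R := (alpha - beta) / (alpha + beta).

Definition xi (p : R) : R :=
  if p == 0 then 0
  else Num.sqrt p * (2 / (2 - p)) `^ (1 / 2 - 1 / p).

Definition adjoint m n (A : 'M[R[i]]_(m, n)) : 'M[R[i]]_(n, m) :=
  map_mx (@Num.conj R[i]) A^T.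

(* [P] selects, for every point, one of its (possibly many) nearest points
   in [Q]. *)
Definition is_projection n (Q : set 'cV[R[i]]_n)
    (P : 'cV[R[i]]_n -> 'cV[R[i]]_n) : Prop :=
  forall z, Q (P z) /\
    forall u, Q u -> l2norm (z - P z) ^+ 2 <= l2norm (z - u) ^+ 2.

Definition pgd_iterates m n (A : 'M[R[i]]_(m, n)) (y : 'cV[R[i]]_m)
    (Q : set 'cV[R[i]]_n) (P : 'cV[R[i]]_n -> 'cV[R[i]]_n)
    (eta : nat -> R) (x : nat -> 'cV[R[i]]_n) : Prop :=
  Q (x 0%N) /\
  forall k, x k.+1 = P (x k - (eta k)%:C *: (adjoint A *m (A *m x k - y))).

End PGD.

(* Main.v *)
(* The scaled signal z = (1 - eps) xstar lies on the boundary of the ball, so the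
   projection inequality at z bounds |x_{k+1} - z|^2 by twice
   <d, d'> - eta <A d, A d'> plus a noise term, where d = x_k - z and
   d' = x_{k+1} - z.  Membership in the ball forces the l_p mass of d off the
   support of xstar below its mass on the support.  Hence, sorting the entries
   off the support into blocks, all but the first block have l_2 norms summing
   to at most sqrt 2 * xi p * |d| for blocks of size s, and xi p * |d| for
   blocks of size 2s.  The restricted isometry property applied to each pair
   of blocks of d and d' then gives |d'| <= 2 gamma |d| + C. *)

Require Import Defs.
From HB Require Import structures.
From mathcomp Require Import all_boot all_order all_algebra.
From mathcomp Require Import complex.
From mathcomp Require Import classical_sets reals exp.
From mathcomp Require Import ring lra zify.

Set Implicit Arguments.
Unset Strict Implicit.
Unset Printing Implicit Defensive.

Import Order.TTheory GRing.Theory Num.Theory.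

Local Open Scope ring_scope.

(** * Real inner product and Euclidean norm on complex vectors *)

Section InnerProduct.
Context {R : realType}.
Implicit Types (m n : nat) (t : R).

(** The real part of the Hermitian inner product, that is, the Euclidean inner product of C^n seen
    as R^(2n); expanding squared norms involves only this part. *)
Definition re_dot n (u v : 'cV[R[i]]_n) : R :=
  \sum_(i < n) (complex.Re (u i 0) * complex.Re (v i 0)
                + complex.Im (u i 0) * complex.Im (v i 0)).

Lemma re_dotC n (u v : 'cV[R[i]]_n) : re_dot u v = re_dot v u.
Proof. by apply: eq_bigr => i _; ring. Qed.

Lemma re_dotDl n (u v w : 'cV[R[i]]_n) :
  re_dot (u + v) w = re_dot u w + re_dot v w.
Proof.
rewrite -big_split; apply: eq_bigr => i _; rewrite mxE.
by case: (u i 0) (v i 0) => a b [c d] /=; ring.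
Qed.

Lemma re_dotZl n t (u w : 'cV[R[i]]_n) :
  re_dot (t%:C%C *: u) w = t * re_dot u w.
Proof.
rewrite mulr_sumr; apply: eq_bigr => i _; rewrite mxE.
by case: (u i 0) => a b /=; ring.
Qed.

Lemma re_dot0l n (w : 'cV[R[i]]_n) : re_dot 0 w = 0.
Proof. by apply: big1 => i _; rewrite mxE /= !mul0r addr0. Qed.

Lemma re_dotNl n (u w : 'cV[R[i]]_n) : re_dot (- u) w = - re_dot u w.
Proof. by apply/eqP; rewrite -subr_eq0 opprK -re_dotDl addNr re_dot0l. Qed.

Lemma re_dotBl n (u v w : 'cV[R[i]]_n) :
  re_dot (u - v) w = re_dot u w - re_dot v w.
Proof. by rewrite re_dotDl re_dotNl. Qed.

Lemma re_dotDr n (u v w : 'cV[R[i]]_n) :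
  re_dot w (u + v) = re_dot w u + re_dot w v.
Proof. by rewrite re_dotC re_dotDl !(re_dotC _ w). Qed.

Lemma re_dotBr n (u v w : 'cV[R[i]]_n) :
  re_dot w (u - v) = re_dot w u - re_dot w v.
Proof. by rewrite re_dotC re_dotBl !(re_dotC _ w). Qed.

Lemma re_dotZr n t (u w : 'cV[R[i]]_n) :
  re_dot w (t%:C%C *: u) = t * re_dot w u.
Proof. by rewrite re_dotC re_dotZl re_dotC. Qed.

(** Once the products are written with conjugates, both sides are real parts of one double sum,
    taken in the two orders of summation. *)
Lemma re_dot_adjoint m n (A : 'M[R[i]]_(m, n)) w d :
  re_dot (adjoint A *m w) d = re_dot w (A *m d).
Proof.
have dotE k (u v : 'cV[R[i]]_k) :
  re_dot u v = complex.Re (\sum_i u i 0 * conjc (v i 0)).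
  rewrite (raddf_sum (@complex.Re R : Rcomplex R -> R)).
  apply: eq_bigr => i _.
  by case: (u i 0) (v i 0) => a b [c e] /=; ring.
rewrite !dotE; congr complex.Re.
under eq_bigr do rewrite mxE big_distrl /=.
rewrite exchange_big; apply: eq_bigr => j _ /=.
rewrite mxE rmorph_sum big_distrr /=; apply: eq_bigr => i _.
rewrite !mxE rmorphM /= -[Num.conj _]/(conjc _); ring.
Qed.

Lemma modulus_sqr (z : R[i]) :
  modulus z ^+ 2 = complex.Re z ^+ 2 + complex.Im z ^+ 2.
Proof.
by case: z => a b; rewrite /modulus /= sqr_sqrtr // addr_ge0 // sqr_ge0.
Qed.

Lemma modulus_ge0 (z : R[i]) : 0 <= modulus z.
Proof. by case: z => a b; apply: sqrtr_ge0. Qed.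

Lemma modulus_eq0 (z : R[i]) : (modulus z == 0) = (z == 0).
Proof.
apply/eqP/eqP => [/Normc.eq0_normc //|->]; exact: Normc.normc0.
Qed.

Lemma modulusN (z : R[i]) : modulus (- z) = modulus z.
Proof. exact: normcN. Qed.

Lemma l2norm_ge0 n (u : 'cV[R[i]]_n) : 0 <= l2norm u.
Proof. exact: sqrtr_ge0. Qed.

Lemma sum_modulus_sqr_ge0 n (P : pred 'I_n) (u : 'cV[R[i]]_n) :
  0 <= \sum_(i < n | P i) modulus (u i 0) ^+ 2.
Proof. by apply: sumr_ge0 => i _; apply: sqr_ge0. Qed.

Lemma l2norm_sqr n (u : 'cV[R[i]]_n) :
  l2norm u ^+ 2 = \sum_(i < n) modulus (u i 0) ^+ 2.
Proof. by rewrite sqr_sqrtr // sum_modulus_sqr_ge0. Qed.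

Lemma re_dotxx n (u : 'cV[R[i]]_n) : re_dot u u = l2norm u ^+ 2.
Proof.
by rewrite l2norm_sqr; apply: eq_bigr => i _; rewrite modulus_sqr !expr2.
Qed.

Lemma l2norm_eq0 n (u : 'cV[R[i]]_n) : l2norm u = 0 -> u = 0.
Proof.
move=> u0; have /eqP := l2norm_sqr u; rewrite u0 expr0n /= eq_sym.
rewrite psumr_eq0 => [/allP h|i _]; last exact: sqr_ge0.
apply/matrixP => i j; rewrite (ord1 j) mxE.
by have := h i (mem_index_enum _); rewrite expf_eq0 /= modulus_eq0 => /eqP.
Qed.

(** Cauchy-Schwarz: with [a], [b] the two norms and [c] the product, the squared norm of b u - a v
    equals 2ab(ab - c). *)
Lemma re_dot_le n (u v : 'cV[R[i]]_n) : re_dot u v <= l2norm u * l2norm v.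
Proof.
have [u0|u0] := eqVneq (l2norm u) 0.
  by rewrite u0 mul0r (l2norm_eq0 u0) re_dot0l.
have [v0|v0] := eqVneq (l2norm v) 0.
  by rewrite v0 mulr0 (l2norm_eq0 v0) re_dotC re_dot0l.
have := sqr_ge0 (l2norm ((l2norm v)%:C%C *: u - (l2norm u)%:C%C *: v)).
rewrite -re_dotxx re_dotBl !re_dotBr !re_dotZl !re_dotZr (re_dotC v u) !re_dotxx.
set a := l2norm u in u0 *; set b := l2norm v in v0 *; set c := re_dot u v => h.
have ab : 0 < a * b by rewrite mulr_gt0 // lt_def ?u0 ?v0 l2norm_ge0.
by rewrite -subr_ge0 -(pmulr_rge0 _ ab); lra.
Qed.

Lemma l2normN n (u : 'cV[R[i]]_n) : l2norm (- u) = l2norm u.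
Proof. by congr Num.sqrt; apply: eq_bigr => i _; rewrite mxE modulusN. Qed.

Lemma l2norm0 n : l2norm (0 : 'cV[R[i]]_n) = 0.
Proof. by apply/eqP; rewrite -sqrf_eq0 -re_dotxx re_dot0l. Qed.

Lemma l2normZ n t (u : 'cV[R[i]]_n) : l2norm (t%:C%C *: u) = `|t| * l2norm u.
Proof.
apply/eqP; rewrite -(eqrXn2 (n := 2)) ?mulr_ge0 ?l2norm_ge0 //.
by rewrite exprMn -!re_dotxx re_dotZl re_dotZr real_normK ?num_real // expr2 mulrA.
Qed.

Lemma l2normD n (u v : 'cV[R[i]]_n) : l2norm (u + v) <= l2norm u + l2norm v.
Proof.
rewrite -(ler_pXn2r (n := 2)) ?nnegrE ?addr_ge0 ?l2norm_ge0 //.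
rewrite -re_dotxx re_dotDl !re_dotDr !re_dotxx (re_dotC v u).
by have := re_dot_le u v; lra.
Qed.

Lemma l2norm_sum n (l : seq 'cV[R[i]]_n) :
  l2norm (\sum_(u <- l) u) <= \sum_(u <- l) l2norm u.
Proof.
elim: l => [|u l IH]; first by rewrite !big_nil l2norm0.
by rewrite !big_cons (le_trans (l2normD _ _)) // lerD2l.
Qed.

End InnerProduct.

(** * Restricted isometry for pairs and sums of sparse vectors *)

Section RestrictedIsometry.
Context {R : realType} {m n : nat} (A : 'M[R[i]]_(m, n)).
Implicit Types (u v : 'cV[R[i]]_n) (W : {set 'I_n}).

Definition supported W u := forall i, i \notin W -> u i 0 = 0.

Lemma supported_sparse W u r : (#|W| <= r)%N -> supported W u -> sparse r u.
Proof.
move=> Wr Wu; apply: leq_trans Wr; apply/subset_leq_card/fintype.subsetP => i.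
by rewrite inE; apply: contraR => /Wu ->.
Qed.

Lemma supportedD W u v : supported W u -> supported W v -> supported W (u + v).
Proof. by move=> Wu Wv i iW; rewrite mxE Wu // Wv // addr0. Qed.

Lemma supportedZ W a u : supported W u -> supported W (a *: u).
Proof. by move=> Wu i iW; rewrite mxE Wu // mulr0. Qed.

Lemma supportedS W W' u : W \subset W' -> supported W u -> supported W' u.
Proof.
by move=> /fintype.subsetP sub Wu i iW; apply: Wu; apply: contra iW; apply: sub.
Qed.

(** Polarization: four times the left side is the form |w|^2 - eta |A w|^2 at w = u + v minus its
    value at w = u - v. Both arguments live on [W], so the lower constant bounds the first value and
    the upper constant the second. *)
Lemma rip_dot_le W r (alpha beta eta tau : R) u v :
  (#|W| <= r)%N -> supported W u -> supported W v ->
  rip_upper A r alpha -> rip_lower A r beta ->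
  beta <= alpha -> 0 < alpha + beta -> 0 < eta ->
  `|eta * (alpha + beta) / 2 - 1| <= tau ->
  re_dot u v - eta * re_dot (A *m u) (A *m v) <=
    ((1 + tau) * ric_ratio alpha beta + tau) * (l2norm u * l2norm v).
Proof.
move=> Wr Wu Wv [_ up] [_ lo] ba ab eta0 htau.
set delta := (X in _ <= X * _).
have symm u1 v1 : supported W u1 -> supported W v1 ->
    re_dot u1 v1 - eta * re_dot (A *m u1) (A *m v1) <=
    delta * ((l2norm u1 ^+ 2 + l2norm v1 ^+ 2) / 2).
  move=> Wu1 Wv1.
  have hlo := lo (u1 + v1) (supported_sparse Wr (supportedD Wu1 Wv1)).
  have hup : l2norm (A *m (u1 - v1)) ^+ 2 <= alpha * l2norm (u1 - v1) ^+ 2.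
    apply/up/(supported_sparse Wr)/supportedD => // i iW.
    by rewrite mxE Wv1 // oppr0.
  have [hb ha] : 1 - eta * beta <= delta /\ eta * alpha - 1 <= delta.
    have rho0 : 0 <= ric_ratio alpha beta by rewrite divr_ge0 ?subr_ge0 // ltW.
    (* With t = eta (alpha + beta) / 2, one has eta alpha = t (1 + rho) and eta beta = t (1 - rho),
       while t differs from 1 by at most tau. *)
    have e1 : eta * (alpha - beta) / 2 =
        eta * (alpha + beta) / 2 * ric_ratio alpha beta.
      by rewrite /ric_ratio; field; rewrite gt_eqF.
    move: htau rho0 e1; rewrite /delta ler_norml; clear.
    move: (ric_ratio alpha beta) => rho /andP[h1 h2] rho0 e1.
    have h3 : eta * (alpha + beta) / 2 * rho <= (1 + tau) * rho.
      by apply: ler_wpM2r => //; lra.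
    by split; lra.
  have sp := sqr_ge0 (l2norm (u1 + v1)); have sm := sqr_ge0 (l2norm (u1 - v1)).
  have h1 := ler_wpM2r sp hb; have h2 := ler_wpM2r sm ha.
  have h3 := ler_wpM2l (ltW eta0) hlo; have h4 := ler_wpM2l (ltW eta0) hup.
  move: h1 h2 h3 h4; rewrite mulmxBr mulmxDr.
  rewrite -!re_dotxx !(re_dotBl, re_dotDl, re_dotBr, re_dotDr).
  rewrite (re_dotC v1 u1) (re_dotC (A *m v1) (A *m u1)).
  by move: (delta); clear => d; lra.
have [u0|u0] := eqVneq (l2norm u) 0.
  by rewrite u0 mul0r (l2norm_eq0 u0) mulmx0 !re_dot0l !mulr0 subr0.
have [v0|v0] := eqVneq (l2norm v) 0.
  rewrite v0 mulr0 (l2norm_eq0 v0) mulmx0 !(re_dotC _ 0) !re_dot0l.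
  by rewrite !mulr0 subr0.
have uv : 0 < l2norm u * l2norm v by rewrite mulr_gt0 // lt_def ?u0 ?v0 l2norm_ge0.
(* Scaling both vectors to the norm |u||v| turns the mean of squares into the
   product. *)
have := symm _ _ (supportedZ (l2norm v)%:C%C Wu) (supportedZ (l2norm u)%:C%C Wv).
rewrite -!scalemxAr !re_dotZl !re_dotZr !l2normZ !ger0_norm ?l2norm_ge0 //.
by move=> h; rewrite -subr_ge0 -(pmulr_rge0 _ uv); lra.
Qed.

(** Expanding both sums bilinearly, the bounds over all pairs add up to a product of two sums. [G]
    stands for the form of [rip_dot_le]. *)
Lemma rip_dot_sum_le (G : 'cV[R[i]]_n -> 'cV[R[i]]_n -> R) delta
    (l l' : seq 'cV[R[i]]_n) :
  (forall u v, G u v = G v u) ->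
  (forall u v w, G (u + v) w = G u w + G v w) ->
  {in l & l', forall u v, G u v <= delta * (l2norm u * l2norm v)} ->
  G (\sum_(u <- l) u) (\sum_(v <- l') v) <=
    delta * ((\sum_(u <- l) l2norm u) * \sum_(v <- l') l2norm v).
Proof.
move=> GC GD.
have G0 w : G 0 w = 0 by apply: (addrI (G 0 w)); rewrite -GD !addr0.
elim: l => [|u l IH] h; first by rewrite !big_nil G0 mul0r mulr0.
rewrite !big_cons GD mulrDl mulrDr lerD //; last first.
  by apply: IH => a b al; apply: h; rewrite inE al orbT.
have {IH}h v : v \in l' -> G u v <= delta * (l2norm u * l2norm v).
  by apply: h; rewrite inE eqxx.
elim: l' h => [|v l' IH] h; first by rewrite !big_nil GC G0 !mulr0.
rewrite !big_cons GC GD !(GC _ u) mulrDr mulrDr lerD ?h ?inE ?eqxx //.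
by apply: IH => w wl; apply: h; rewrite inE wl orbT.
Qed.

Lemma rip_norm_sum_le r alpha (l : seq 'cV[R[i]]_n) :
  rip_upper A r alpha -> {in l, forall u, sparse r u} ->
  l2norm (A *m \sum_(u <- l) u) <= Num.sqrt alpha * \sum_(u <- l) l2norm u.
Proof.
move=> [a0 up] lr; rewrite mulmx_sumr.
have := l2norm_sum [seq A *m u | u <- l]; rewrite !big_map => /le_trans; apply.
rewrite mulr_sumr big_seq [leRHS]big_seq; apply: ler_sum => u ul.
rewrite -(ler_pXn2r (n := 2)) ?nnegrE ?mulr_ge0 ?l2norm_ge0 ?sqrtr_ge0 //.
by rewrite exprMn (sqr_sqrtr a0); apply/up/lr.
Qed.

End RestrictedIsometry.

(** * Inequalities between real powers and the constant [xi] *)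

Section PowerInequalities.
Context {R : realType}.
Implicit Types (a b p t : R).

(** Young's inequality with conjugate exponents 1/t and 1/(1 - t). *)
Lemma weighted_AMGM t a b : 0 < t < 1 -> 0 <= a -> 0 <= b ->
  a `^ t * b `^ (1 - t) <= t * a + (1 - t) * b.
Proof.
move=> /andP[t0 t1] a0 b0.
have t1' : 0 < 1 - t by rewrite subr_gt0.
have := @conjugate_powR R (a `^ t) (b `^ (1 - t)) t^-1 (1 - t)^-1.
rewrite !powR_ge0 !invr_gt0 t0 t1' !invrK -!powRrM !divff ?gt_eqF //.
rewrite !powRr1 // (mulrC t) (mulrC (1 - t)); apply => //.
by rewrite addrC subrK.
Qed.

(** On [0, 1] one has x <= x^p; this is applied to a/(a + b) and b/(a + b), which sum to 1. *)
Lemma powR_subadd p a b : 0 < p <= 1 -> 0 <= a -> 0 <= b ->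
  (a + b) `^ p <= a `^ p + b `^ p.
Proof.
move=> /andP[p0 p1] a0 b0; have [->|ab0] := eqVneq (a + b) 0.
  by rewrite powR0 ?gt_eqF // addr_ge0 ?powR_ge0.
have ab : 0 < a + b by rewrite lt_def ab0 addr_ge0.
have scale c : 0 <= c -> c <= a + b -> c / (a + b) * (a + b) `^ p <= c `^ p.
  move=> c0 cab; have [->|c0'] := eqVneq c 0.
    by rewrite !mul0r powR_ge0.
  have cp : 0 < c by rewrite lt_def c0'.
  have -> : c `^ p = (c / (a + b)) `^ p * (a + b) `^ p.
    by rewrite -powRM ?divfK // ?ltW // divr_gt0.
  apply: ler_wpM2r; first exact: powR_ge0.
  by apply: ger1_powR => //; rewrite divr_gt0 // ler_pdivrMr // mul1r.
have := lerD (scale a a0 _) (scale b b0 _).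
rewrite -mulrDl -mulrDl divff // mul1r; apply; lra.
Qed.

(* The maximum of [x `^ (1/p - 1/2) * y `^ (1/2)] on the segment [x + y = 1]. *)
Definition block_const p : R := (1 - p / 2) `^ (1 / p - 1 / 2) * (p / 2) `^ (1 / 2).

Lemma block_const_ge0 p : 0 <= block_const p.
Proof. by rewrite mulr_ge0 ?powR_ge0. Qed.

Lemma xi_block_const p : 0 < p <= 1 -> xi p = Num.sqrt 2 * block_const p.
Proof.
move=> /andP[p0 p1]; rewrite /xi /block_const gt_eqF //.
have -> : Num.sqrt p = Num.sqrt 2 * (p / 2) `^ (1 / 2).
  rewrite div1r powR12_sqrt ?divr_ge0 ?ltW // -sqrtrM //.
  by congr Num.sqrt; field.
have -> : 2 / (2 - p) = (1 - p / 2)^-1.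
  by rewrite -invf_div mulrBl divff // pnatr_eq0.
rewrite -(@powR_inv1 _ (1 - p / 2)); last lra.
rewrite -powRrM -mulrA; congr (_ * _); rewrite mulrC; congr (_ `^ _ * _).
by rewrite mulN1r opprB.
Qed.

Lemma xi_ge0 p : 0 <= xi p.
Proof. by rewrite /xi; case: ifP => // _; rewrite mulr_ge0 ?sqrtr_ge0 ?powR_ge0. Qed.

(** Weighted AM-GM with t = p/2, applied to b/t and a/(1 - t), then raised to the power 1/p. *)
Lemma block_const_le p a b : 0 < p <= 1 -> 0 <= a -> 0 <= b ->
  a `^ (1 / p - 1 / 2) * b `^ (1 / 2) <= block_const p * (a + b) `^ (1 / p).
Proof.
move=> /andP[p0 p1] a0 b0; rewrite /block_const.
have [t tE] : exists t, t = p / 2 by exists (p / 2).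
rewrite -tE.
have t0 : 0 < t by rewrite tE divr_gt0.
have t1 : 0 < 1 - t by lra.
have tp : t * (1 / p) = 1 / 2 by rewrite tE; field; rewrite gt_eqF.
have tp' : (1 - t) * (1 / p) = 1 / p - 1 / 2 by rewrite mulrBl tp (mul1r (1 / p)).
have H : b `^ t * a `^ (1 - t) <= t `^ t * (1 - t) `^ (1 - t) * (a + b).
  have tI : 0 < t < 1 by rewrite t0 -subr_gt0.
  have bt := divr_ge0 b0 (ltW t0); have at' := divr_ge0 a0 (ltW t1).
  have := weighted_AMGM tI bt at'.
  rewrite mulrCA divff ?gt_eqF // mulr1 mulrCA divff ?gt_eqF // mulr1 (addrC a).
  rewrite -(ler_pM2l (x := t `^ t * (1 - t) `^ (1 - t))) ?mulr_gt0 ?powR_gt0 //.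
  move=> h; apply: le_trans h; rewrite mulrACA -!powRM ?(ltW t0) ?(ltW t1) //.
  by rewrite (mulrC t) (mulrC (1 - t)) !divfK ?gt_eqF.
have p' : 0 <= 1 / p by rewrite divr_ge0 // ltW.
have := ge0_ler_powR p' _ _ H; rewrite !nnegrE ?mulr_ge0 ?powR_ge0 ?addr_ge0 //.
move=> /(_ isT isT) /=; rewrite !powRM ?mulr_ge0 ?powR_ge0 ?addr_ge0 // -!powRrM.
by rewrite tp tp' mulrC (mulrC (t `^ _)).
Qed.

End PowerInequalities.

(** Built greedily, adding a maximizer of [f] among the remaining elements; this replaces sorting
    the entries by size. *)
Lemma exists_top_subset (R : realDomainType) (I : finType) (f : I -> R)
    (T : {set I}) r :
  (r <= #|T|)%N -> exists G : {set I}, [/\ G \subset T, #|G| = r &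
    {in G & T :\: G, forall i j, f j <= f i}].
Proof.
elim: r => [_|r IH rT].
  by exists finset.set0; split; rewrite ?finset.sub0set ?cards0 // => i j; rewrite inE.
have [G [GT Gr top]] := IH (ltnW rT).
have /card_gt0P[i0 i0T] : (0 < #|T :\: G|)%N.
  by rewrite cardsD (finset.setIidPr GT) Gr subn_gt0.
case: (arg_maxP f i0T) => k kT kmax.
have /setDP[kT' kG] : k \in T :\: G := kT.
exists (k |: G)%SET; split.
- by rewrite finset.subUset GT finset.sub1set kT'.
- by rewrite cardsU1 kG Gr.
- move=> i j; rewrite !inE negb_or => /orP[/eqP->|iG] /andP[/andP[jk jG] jT].
    by apply: kmax; apply/setDP.
  by apply: top; rewrite // !inE jG.
Qed.

(** * Splitting a vector into blocks of decreasing entries *)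

Section BlockDecomposition.
Context {R : realType} {n : nat}.
Implicit Types (d u : 'cV[R[i]]_n) (S T G : {set 'I_n}) (p a : R).

Definition restrict_cV T d : 'cV[R[i]]_n := \col_i (if i \in T then d i 0 else 0).

Lemma supported_restrict T d : supported T (restrict_cV T d).
Proof. by move=> i iT; rewrite mxE (negbTE iT). Qed.

Lemma restrictD T G d :
  G \subset T -> restrict_cV T d = restrict_cV G d + restrict_cV (T :\: G) d.
Proof.
move=> /fintype.subsetP GT; apply/matrixP => i j; rewrite !mxE inE.
by have [/GT ->|] := boolP (i \in G); rewrite ?addr0 ?add0r.
Qed.

Lemma l2norm_restrict T d :
  l2norm (restrict_cV T d) ^+ 2 = \sum_(i in T) modulus (d i 0) ^+ 2.
Proof.
rewrite l2norm_sqr [RHS]big_mkcond; apply: eq_bigr => i _; rewrite mxE.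
by case: ifP => // _; rewrite [modulus 0]Normc.normc0 expr0n.
Qed.

Lemma l2norm_restrict_le T d : l2norm (restrict_cV T d) <= l2norm d.
Proof.
rewrite -(ler_pXn2r (n := 2)) ?nnegrE ?l2norm_ge0 // l2norm_restrict l2norm_sqr.
by rewrite [leRHS](bigID (mem T)) /= lerDl sum_modulus_sqr_ge0.
Qed.

Definition lp_mass p T d : R := \sum_(i in T) modulus (d i 0) `^ p.

Lemma lp_mass_ge0 p T d : 0 <= lp_mass p T d.
Proof. by apply: sumr_ge0 => i _; apply: powR_ge0. Qed.

Lemma lp_massD p T G d :
  G \subset T -> lp_mass p T d = lp_mass p G d + lp_mass p (T :\: G) d.
Proof. by move=> GT; rewrite /lp_mass (big_setID G) (finset.setIidPr GT). Qed.

(** Writing |d_i|^2 as (|d_i|^p)^(2/p - 1) |d_i|^p and bounding the first factor by [a] leaves r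
    a^(2/p - 1) b with b the mass divided by r; [block_const_le] bounds its square root. *)
Lemma block_norm_le p r G d a : 0 < p <= 1 -> (0 < r)%N -> 0 <= a ->
  {in G, forall i, modulus (d i 0) `^ p <= a} ->
  l2norm (restrict_cV G d) <=
    Num.sqrt r%:R * (block_const p * (a + lp_mass p G d / r%:R) `^ (1 / p)).
Proof.
move=> p01 r0 a0 Ga; have /andP[p0 p1] := p01.
have r0' : 0 < r%:R :> R by rewrite ltr0n.
have b0 : 0 <= lp_mass p G d / r%:R by rewrite divr_ge0 ?lp_mass_ge0 // ltW.
apply: le_trans (ler_wpM2l (sqrtr_ge0 _) (block_const_le p01 a0 b0)).
rewrite -(ler_pXn2r (n := 2)) ?nnegrE ?mulr_ge0 ?l2norm_ge0 ?sqrtr_ge0 ?powR_ge0 //.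
rewrite l2norm_restrict !exprMn (sqr_sqrtr (ltW r0')).
rewrite -[_ `^ (1 / 2) ^+ 2]powR_mulrn ?powR_ge0 // -powRrM divfK ?pnatr_eq0 //.
rewrite powRr1 // mulrCA [_ * (_ / _)]mulrC divfK ?gt_eqF // mulr_sumr.
apply: ler_sum => i iG; rewrite -[_ `^ _ ^+ 2]powR_mulrn ?powR_ge0 // -powRrM.
set x := modulus _; have [->|x0] := eqVneq x 0.
  by rewrite expr0n mulr_ge0 ?powR_ge0.
have -> : x ^+ 2 = (x `^ p) `^ ((1 / p - 1 / 2) * 2) * x `^ p.
  rewrite -powRrM -powRD ?x0 ?implybT // -powR_mulrn ?modulus_ge0 //.
  by congr (_ `^ _); field; rewrite gt_eqF.
apply: ler_wpM2r; first exact: powR_ge0.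
apply: ge0_ler_powR; rewrite ?nnegrE ?powR_ge0 //; last exact: Ga.
have -> : (1 / p - 1 / 2) * 2 = (2 - p) / p by field; rewrite gt_eqF.
by apply: divr_ge0; lra.
Qed.

(* [a] is the average of [|d_i|^p] over the preceding block; the weight 2 appears
   because the mass of a block enters its own bound and that of the next one. *)
Lemma block_chain p r T d a K : 0 < p <= 1 -> (0 < r)%N -> 0 <= a ->
  {in T, forall i, modulus (d i 0) `^ p <= a} ->
  a + lp_mass p T d / r%:R <= K ->
  exists l : seq 'cV[R[i]]_n,
  [/\ restrict_cV T d = \sum_(u <- l) u,
      {in l, forall u, exists2 G : {set 'I_n}, (#|G| <= r)%N & supported G u} &
      \sum_(u <- l) l2norm u <= Num.sqrt r%:R *
        (block_const p * (K `^ (1 / p - 1) * (a + 2 * (lp_mass p T d / r%:R))))].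
Proof.
move=> p01 r0; have /andP[p0 p1] := p01.
have r0' : 0 < r%:R :> R by rewrite ltr0n.
have inv0 T' : 0 <= lp_mass p T' d / r%:R by rewrite divr_ge0 ?lp_mass_ge0 // ltW.
have [k] := ubnP #|T|; elim: k T a => // k IH T a Tk a0 Ta TK.
(* The power X^(1/p) is X X^(1/p - 1) <= X K^(1/p - 1), so the block bounds become linear in the
   masses and can be added. *)
have linearize G : G \subset T -> l2norm (restrict_cV G d) <= Num.sqrt r%:R *
    (block_const p * (K `^ (1 / p - 1) * (a + lp_mass p G d / r%:R))).
  move=> GT; have Ga : {in G, forall i, modulus (d i 0) `^ p <= a}.
    by move=> i /(fintype.subsetP GT); apply: Ta.
  apply: le_trans (block_norm_le p01 r0 a0 Ga) _.
  apply: ler_wpM2l; first exact: sqrtr_ge0.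
  apply: ler_wpM2l; first exact: block_const_ge0.
  have x0 : 0 <= a + lp_mass p G d / r%:R by rewrite addr_ge0.
  have xK : a + lp_mass p G d / r%:R <= K.
    apply: le_trans TK; rewrite lerD2l ler_pM2r ?invr_gt0 //.
    by rewrite (lp_massD _ _ GT) lerDl lp_mass_ge0.
  rewrite -mulr_powRB1 ?divr_gt0 // mulrC; apply: ler_wpM2r => //.
  have e0 : 0 <= 1 / p - 1 by rewrite subr_ge0 lter_pdivlMr // mul1r.
  by apply: ge0_ler_powR => //; apply: le_trans xK.
have c0 x y : x <= y ->
    Num.sqrt r%:R * (block_const p * (K `^ (1 / p - 1) * x)) <=
    Num.sqrt r%:R * (block_const p * (K `^ (1 / p - 1) * y)).
  by move=> xy; rewrite !ler_wpM2l ?sqrtr_ge0 ?block_const_ge0 ?powR_ge0.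
have [Tr|rT] := leqP #|T| r.
  exists [:: restrict_cV T d]; rewrite !big_seq1; split => //.
    by move=> u; rewrite inE => /eqP ->; exists T => //; apply: supported_restrict.
  apply: le_trans (linearize T (fintype.subxx _)) _.
  by apply: c0; have := inv0 T; lra.
have [G [GT Gr top]] := exists_top_subset (fun i => modulus (d i 0) `^ p) (ltnW rT).
have Tmass := lp_massD p d GT; set T' := (T :\: G)%SET in top Tmass *.
(* Each entry left over is below every entry of [G], hence below the average over [G], which serves
   as the next [a]. *)
have T'b : {in T', forall i, modulus (d i 0) `^ p <= lp_mass p G d / r%:R}.
  move=> j jT'; rewrite ler_pdivlMr // mulr_natr -Gr -sumr_const.
  by apply: ler_sum => i iG; apply: top.
have T'k : (#|T'| < k)%N.
  by rewrite /T' cardsD (finset.setIidPr GT) Gr; lia.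
have T'K : lp_mass p G d / r%:R + lp_mass p T' d / r%:R <= K.
  by rewrite -mulrDl -Tmass; apply: le_trans TK; rewrite lerDr.
have [l [ld lr lsum]] := IH T' _ T'k (inv0 G) T'b T'K.
exists (restrict_cV G d :: l); rewrite !big_cons -ld; split.
- exact: restrictD.
- move=> u; rewrite inE => /orP[/eqP ->|/lr //].
  by exists G; rewrite ?Gr //; apply: supported_restrict.
(* In units of 1/r, the bounds (a + g) and (g + 2 t') for the masses g of [G] and t' of [T'] add to
   a + 2 (g + t'). *)
- apply: le_trans (lerD (linearize G GT) lsum) _.
  by rewrite -!mulrDr Tmass; apply: c0; lra.
Qed.

(** Power mean inequality between exponents p and 2. AM-GM of weight p/2 between |d_i|^2 and m =
    |d|^2 / s is summed over [S], and the total is at most s m. *)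
Lemma power_mean_le p s S d : 0 < p <= 1 -> (0 < s)%N -> (#|S| <= s)%N ->
  Num.sqrt s%:R * (lp_mass p S d / s%:R) `^ (1 / p) <= l2norm d.
Proof.
move=> p01 s0 Ss; have /andP[p0 p1] := p01.
have s0' : 0 < s%:R :> R by rewrite ltr0n.
have ip0 : 0 <= 1 / p by rewrite divr_ge0 // ltW.
set m : R := l2norm d ^+ 2 / s%:R.
have m0 : 0 <= m by rewrite divr_ge0 ?sqr_ge0 // ltW.
suff mean : lp_mass p S d / s%:R <= m `^ (p / 2).
  have -> : l2norm d = Num.sqrt s%:R * (m `^ (p / 2)) `^ (1 / p).
    rewrite -powRrM; have -> : p / 2 * (1 / p) = 2^-1 by field; rewrite gt_eqF.
    rewrite powR12_sqrt // -sqrtrM ?ltW // mulrC divfK ?gt_eqF //.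
    by rewrite sqrtr_sqr ger0_norm // l2norm_ge0.
  apply: ler_wpM2l; first exact: sqrtr_ge0.
  by apply: ge0_ler_powR; rewrite ?nnegrE ?powR_ge0 ?divr_ge0 ?lp_mass_ge0 // ltW.
have [d0|d0] := eqVneq (l2norm d) 0.
  rewrite [lp_mass _ _ _]big1 ?mul0r ?powR_ge0 // => i _.
  by rewrite (l2norm_eq0 d0) mxE [modulus 0]Normc.normc0 powR0 // gt_eqF.
have mp : 0 < m.
  by rewrite divr_gt0 // exprn_gt0 // lt_def d0 l2norm_ge0.
have t01 : 0 < p / 2 < 1 by apply/andP; split; lra.
have mE : m `^ (p / 2) * m `^ (1 - p / 2) = m.
  rewrite -powRD ?(gt_eqF mp) ?implybT // addrC subrK powRr1 //.
rewrite ler_pdivrMr // -(ler_pM2r (x := m `^ (1 - p / 2))) ?powR_gt0 //.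
rewrite mulrAC mE mulr_suml.
have amgm i : modulus (d i 0) `^ p * m `^ (1 - p / 2) <=
    (p / 2) * modulus (d i 0) ^+ 2 + (1 - p / 2) * m.
  have := weighted_AMGM t01 (sqr_ge0 (modulus (d i 0))) m0.
  rewrite -(powR_mulrn 2 (modulus_ge0 _)) -powRrM.
  by have -> : 2%:R * (p / 2) = p by field.
apply: le_trans (ler_sum _ (fun i _ => amgm i)) _.
rewrite big_split /= -mulr_sumr sumr_const -l2norm_restrict -mulr_natr.
have h1 : l2norm (restrict_cV S d) ^+ 2 <= m * s%:R.
  rewrite /m divfK ?gt_eqF // ler_pXn2r ?nnegrE ?l2norm_ge0 //.
  exact: l2norm_restrict_le.
have h2 : m * #|S|%:R <= m * s%:R by rewrite ler_pM2l // ler_nat.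
have h3 := ler_wpM2l (ltW (andP t01).1) h1.
have t1 : 0 <= 1 - p / 2 by lra.
by have h4 := ler_wpM2l t1 h2; lra.
Qed.

(** At p = 0 a count replaces the comparison of masses: what lies off [S] has at most [s] non-zero
    entries. *)
Definition lp_cone p s S d : Prop :=
  (0 < p -> lp_mass p (~: S) d <= lp_mass p S d) /\
  (p = 0 -> sparse s (restrict_cV (~: S) d)).

(** The head takes [S] and the [s] largest entries off it; the rest is chained twice from the same
    average [a]. Blocks of size s give the factor a + 2t <= 2K. Blocks of size 2s halve t, so the
    factor is a + t = K, at the cost of a further sqrt 2 from the block size. *)
Lemma cone_decomposition p s S d : 0 <= p <= 1 -> (0 < s)%N -> (#|S| <= s)%N ->
  lp_cone p s S d ->
  exists (S1 : {set 'I_n}) (l l' : seq 'cV[R[i]]_n),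
  [/\ (#|S1| <= s)%N,
      [/\ d = restrict_cV (S :|: S1) d + \sum_(u <- l) u,
          {in l, forall u, exists2 G : {set 'I_n}, (#|G| <= s)%N & supported G u} &
          \sum_(u <- l) l2norm u <= Num.sqrt 2 * xi p * l2norm d] &
      [/\ d = restrict_cV (S :|: S1) d + \sum_(u <- l') u,
          {in l', forall u,
             exists2 G : {set 'I_n}, (#|G| <= 2 * s)%N & supported G u} &
          \sum_(u <- l') l2norm u <= xi p * l2norm d]].
Proof.
move=> /andP[p_ge0 p1] s0 Ss [cone cone0].
set T := [set i | restrict_cV (~: S) d i 0 != 0]%SET.
have TE i : (i \in T) = (i \notin S) && (d i 0 != 0).
  by rewrite inE mxE inE; case: (i \in S); rewrite //= eqxx.
have dT : d = restrict_cV (S :|: T) d.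
  apply/matrixP => i j; rewrite (ord1 j) mxE finset.in_setU TE.
  by have [//|_] := boolP (i \in S); have [->|//] := eqVneq (d i 0) 0.
have xid0 : 0 <= xi p * l2norm d by rewrite mulr_ge0 ?xi_ge0 ?l2norm_ge0.
(* With at most [s] non-zero entries off [S] the tail is empty; this case covers p = 0. *)
have [Ts|sT] := leqP #|T| s.
  exists T, [::], [::]; split; rewrite // !big_nil addr0; split => //.
  by rewrite -mulrA mulr_ge0 ?sqrtr_ge0.
have p0 : 0 < p.
  rewrite lt_def p_ge0 andbT; apply/eqP => p0.
  by have := cone0 p0; rewrite /sparse leqNgt sT.
have p01 : 0 < p <= 1 by rewrite p0.
have s0' : 0 < s%:R :> R by rewrite ltr0n.
have s20 : 0 < (2 * s)%:R :> R by rewrite ltr0n muln_gt0.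
have [S1 [S1T S1s top]] :=
  exists_top_subset (fun i => modulus (d i 0) `^ p) (ltnW sT).
have Tmass := lp_massD p d S1T; set T' := (T :\: S1)%SET in top Tmass.
set a := lp_mass p S1 d / s%:R.
have a0 : 0 <= a by rewrite divr_ge0 ?lp_mass_ge0 // ltW.
have T'a : {in T', forall i, modulus (d i 0) `^ p <= a}.
  move=> j jT'; rewrite ler_pdivlMr // mulr_natr -S1s -sumr_const.
  by apply: ler_sum => i iG; apply: top.
set K := lp_mass p T d / s%:R.
have KE : K = a + lp_mass p T' d / s%:R by rewrite /K Tmass mulrDl.
have T'0 : 0 <= lp_mass p T' d / s%:R by rewrite divr_ge0 ?lp_mass_ge0 // ltW.
have KE2 : lp_mass p T' d / (2 * s)%:R = lp_mass p T' d / s%:R / 2.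
  by rewrite natrM; field; rewrite gt_eqF.
have K0 : 0 <= K by rewrite KE addr_ge0.
(* The product K K^(1/p - 1) is K^(1/p). The cone condition moves the mass from [T] to [S], where
   the power mean inequality applies. *)
have Kd : Num.sqrt s%:R * (K * K `^ (1 / p - 1)) <= l2norm d.
  rewrite mulr_powRB1 ?divr_gt0 //; apply: le_trans (power_mean_le _ p01 s0 Ss).
  apply: ler_wpM2l; first exact: sqrtr_ge0.
  apply: ge0_ler_powR; rewrite ?nnegrE ?divr_ge0 ?lp_mass_ge0 ?(ltW p0) ?(ltW s0') //.
  rewrite ler_pM2r ?invr_gt0 //; apply: le_trans (cone p0).
  have TS : T \subset ~: S by apply/fintype.subsetP => i; rewrite TE inE => /andP[].
  by rewrite (lp_massD _ _ TS) lerDl lp_mass_ge0.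
have dS1 : d = restrict_cV (S :|: S1) d + restrict_cV T' d.
  have SS1 : S :|: S1 \subset S :|: T by apply: finset.setUS.
  rewrite {1}dT (restrictD _ SS1); congr (_ + restrict_cV _ _).
  apply/finset.setP => i; rewrite !(finset.in_setD, finset.in_setU) negb_or.
  have := TE i; case: (i \in T); case: (i \in S) => //= _.
  by rewrite andbF.
have T'K : a + lp_mass p T' d / s%:R <= K by rewrite KE.
have T'K2 : a + lp_mass p T' d / (2 * s)%:R <= K by rewrite KE KE2; lra.
have [l [ld ls lsum]] := block_chain p01 s0 a0 T'a T'K.
have s2 : (0 < 2 * s)%N by rewrite muln_gt0.
have [l' [ld' ls' lsum']] := block_chain p01 s2 a0 T'a T'K2.
have sqrt2 : Num.sqrt 2 * Num.sqrt 2 = 2 :> R by rewrite -expr2 sqr_sqrtr.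
have sqrt2s : Num.sqrt (2 * s)%:R = Num.sqrt 2 * Num.sqrt s%:R :> R.
  by rewrite natrM sqrtrM.
have c0 := block_const_ge0 p.
have Kpow0 : 0 <= K `^ (1 / p - 1) by apply: powR_ge0.
exists S1, l, l'; rewrite S1s -ld -ld' xi_block_const //; split => //; split => //.
- apply: le_trans lsum _.
  have -> : Num.sqrt 2 * (Num.sqrt 2 * block_const p) * l2norm d =
      block_const p * (2 * l2norm d) by rewrite mulrA sqrt2; ring.
  rewrite mulrCA; apply: ler_wpM2l => //.
  have h : Num.sqrt s%:R * (K `^ (1 / p - 1) * (a + 2 * (lp_mass p T' d / s%:R)))
      <= Num.sqrt s%:R * (K `^ (1 / p - 1) * (2 * K)).
    by rewrite !ler_wpM2l ?sqrtr_ge0 //; lra.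
  by apply: le_trans h _; lra.
- apply: le_trans lsum' _; rewrite sqrt2s KE2.
  have -> : a + 2 * (lp_mass p T' d / s%:R / 2) = K by rewrite KE; field; rewrite gt_eqF.
  have -> : Num.sqrt 2 * Num.sqrt s%:R * (block_const p * (K `^ (1 / p - 1) * K)) =
      Num.sqrt 2 * block_const p * (Num.sqrt s%:R * (K * K `^ (1 / p - 1))) by ring.
  by apply: ler_wpM2l => //; rewrite mulr_ge0 ?sqrtr_ge0.
Qed.

End BlockDecomposition.

(** * Estimates for one projected gradient step *)

Section DescentStep.
Context {R : realType}.
Implicit Types (m n s : nat) (p : R).

Lemma lpnorm_powE n p (x : 'cV[R[i]]_n) :
  0 < p -> lpnorm_pow p x = \sum_(i < n) modulus (x i 0) `^ p.
Proof.
move=> p0; rewrite [LHS]big_mkcond; apply: eq_bigr => i _.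
have [->|//] := eqVneq (x i 0) 0.
by rewrite [modulus 0]Normc.normc0 powR0 // gt_eqF.
Qed.

Lemma lpnorm_pow0E n (x : 'cV[R[i]]_n) : lpnorm_pow 0 x = (l0norm x)%:R.
Proof.
rewrite /lpnorm_pow; under eq_bigr do rewrite powRr0.
by rewrite sumr_const /l0norm cardsE.
Qed.

Lemma lpnorm_powZ n p t (x : 'cV[R[i]]_n) :
  0 < t -> lpnorm_pow p (t%:C%C *: x) = t `^ p * lpnorm_pow p x.
Proof.
move=> t0; have tC : t%:C%C != 0 :> R[i].
  by apply/eqP => /(congr1 (@complex.Re R)) /= t0'; rewrite t0' ltxx in t0.
rewrite mulr_sumr; apply: eq_big => i; rewrite mxE ?mulf_eq0 ?(negbTE tC) // => _.
rewrite -powRM ?modulus_ge0 // ?ltW //; congr (_ `^ _).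
rewrite /modulus Normc.normcM; congr (_ * _).
by rewrite /= expr0n addr0 sqrtr_sqr gtr0_norm.
Qed.

(** Off [S] the difference is [x] itself. On [S], subadditivity gives |z_i|^p <= |x_i|^p + |x_i -
    z_i|^p, so the ball constraint leaves [x] no more mass off [S] than the difference has on [S].
    At p = 0 the constraint bounds the number of non-zero entries of [x]. *)
Lemma ball_sub_cone n p s (S : {set 'I_n}) (x z : 'cV[R[i]]_n) : 0 <= p <= 1 ->
  supported S z -> sparse s z -> lpnorm_pow p x <= lpnorm_pow p z ->
  lp_cone p s S (x - z).
Proof.
move=> /andP[p_ge0 p1] Sz sz xz; split => [p0|p0]; last first.
  rewrite p0 !lpnorm_pow0E ler_nat in xz.
  apply: leq_trans sz; apply: leq_trans xz.
  apply/subset_leq_card/fintype.subsetP => i; rewrite !inE !mxE inE.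
  by have [iS|iS] := boolP (i \in S); rewrite ?eqxx //= Sz // subr0.
have p01 : 0 < p <= 1 by rewrite p0.
rewrite !lpnorm_powE // (bigID (mem S)) [leRHS](bigID (mem S)) /= in xz.
have zS : \sum_(i | i \notin S) modulus (z i 0) `^ p = 0.
  apply: big1 => i iS.
  by rewrite Sz // [modulus 0]Normc.normc0 powR0 // gt_eqF.
have xS : lp_mass p (~: S) (x - z) = \sum_(i | i \notin S) modulus (x i 0) `^ p.
  by apply: eq_big => i; rewrite inE // => iS; rewrite !mxE Sz // subr0.
have split_z : \sum_(i in S) modulus (z i 0) `^ p <=
    \sum_(i in S) modulus (x i 0) `^ p + lp_mass p S (x - z).
  rewrite -big_split; apply: ler_sum => i _ /=.
  apply: le_trans (powR_subadd p01 (modulus_ge0 _) (modulus_ge0 _)).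
  apply: ge0_ler_powR; rewrite ?nnegrE ?addr_ge0 ?modulus_ge0 //.
  rewrite !mxE -(modulusN (_ - _)) opprB.
  by have := le_normcD (x i 0) (z i 0 - x i 0); rewrite addrCA subrr addr0.
by rewrite xS; lra.
Qed.

(** Two vectors are decomposed at once, so tail blocks have size s: any two pieces then fit in 3s
    indices. Each vector's pieces have norms summing to at most 1 + sqrt 2 xi times its norm. *)
Lemma cone_rip_dot_le m n (A : 'M[R[i]]_(m, n)) p s (S : {set 'I_n})
    (alpha beta eta tau : R) (d d' : 'cV[R[i]]_n) :
  0 <= p <= 1 -> (0 < s)%N -> (#|S| <= s)%N ->
  lp_cone p s S d -> lp_cone p s S d' ->
  rip_upper A (3 * s)%N alpha -> rip_lower A (3 * s)%N beta ->
  beta <= alpha -> 0 < alpha + beta -> 0 < eta -> 0 <= tau ->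
  `|eta * (alpha + beta) / 2 - 1| <= tau ->
  re_dot d d' - eta * re_dot (A *m d) (A *m d') <=
    ((1 + tau) * ric_ratio alpha beta + tau) * (1 + Num.sqrt 2 * xi p) ^+ 2 *
      (l2norm d * l2norm d').
Proof.
move=> p01 s0 Ss cd cd' up lo ba ab eta0 tau0 htau.
have [S1 [l [_ [S1s [dE ls lsum] _]]]] := cone_decomposition p01 s0 Ss cd.
have [T1 [l' [_ [T1s [dE' ls' lsum'] _]]]] := cone_decomposition p01 s0 Ss cd'.
set delta := (1 + tau) * _ + tau.
have delta0 : 0 <= delta.
  by rewrite addr_ge0 // mulr_ge0 ?addr_ge0 // divr_ge0 ?subr_ge0 // ltW.
pose G (u v : 'cV[R[i]]_n) := re_dot u v - eta * re_dot (A *m u) (A *m v).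
have GC u v : G u v = G v u by rewrite /G re_dotC (re_dotC (A *m u)).
have GD u v w : G (u + v) w = G u w + G v w.
  by rewrite /G mulmxDr !re_dotDl; ring.
have cardU (X Y : {set 'I_n}) a b : (#|X| <= a -> #|Y| <= b -> #|X :|: Y| <= a + b)%N.
  by move=> Xa Yb; rewrite cardsU; apply: leq_trans (leq_subr _ _) (leq_add Xa Yb).
have s3 : (3 * s = s + s + s)%N by rewrite mulSn mul2n -addnn addnA.
have G_le (X Y : {set 'I_n}) u v : (#|X :|: Y| <= 3 * s)%N ->
    supported X u -> supported Y v -> G u v <= delta * (l2norm u * l2norm v).
  move=> XY Xu Yv; apply: (rip_dot_le XY) => //.
    by apply: supportedS Xu; apply: finset.subsetUl.
  by apply: supportedS Yv; apply: finset.subsetUr.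
set h := restrict_cV (S :|: S1) d in dE; set h' := restrict_cV (S :|: T1) d' in dE'.
have SS1 := cardU _ _ _ _ Ss S1s; have ST1 := cardU _ _ _ _ Ss T1s.
have hS : supported (S :|: S1) h by apply: supported_restrict.
have hS' : supported (S :|: T1) h' by apply: supported_restrict.
have pairs : {in h :: l & h' :: l', forall u v, G u v <= delta * (l2norm u * l2norm v)}.
  move=> u v; rewrite !inE => /orP[/eqP ->|/ls[X Xs Xu]] /orP[/eqP ->|/ls'[Y Ys Yv]].
  (* Both heads may have 2s indices, but they share [S], so the union stays within 3s. *)
  - apply: (G_le (S :|: S1) (S :|: T1)) => //; rewrite finset.setUACA finset.setUid.
    by rewrite s3 -addnA !cardU.
  - by apply: (G_le (S :|: S1) Y) => //; rewrite s3 cardU.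
  - by apply: (G_le X (S :|: T1)) => //; rewrite s3 -addnA cardU.
  - by apply: (G_le X Y) => //; rewrite s3 (leq_trans (cardU _ _ _ _ Xs Ys)) ?leq_addr.
have := rip_dot_sum_le GC GD pairs; rewrite !big_cons -dE -dE' => /le_trans; apply.
rewrite -mulrA; apply: ler_wpM2l => //.
have sum_ge0 (k : seq 'cV[R[i]]_n) : 0 <= \sum_(u <- k) l2norm u.
  by apply: sumr_ge0 => u _; apply: l2norm_ge0.
rewrite expr2 mulrACA; apply: ler_pM; rewrite ?addr_ge0 ?l2norm_ge0 // mulrDl mul1r.
  by apply: lerD => //; apply: l2norm_restrict_le.
by apply: lerD => //; apply: l2norm_restrict_le.
Qed.

(** Only one vector is decomposed here, so blocks of size 2s are allowed, which gives 1 + xi in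
    place of 1 + sqrt 2 xi. *)
Lemma cone_rip_norm_le m n (A : 'M[R[i]]_(m, n)) p s (S : {set 'I_n}) (alpha : R)
    (d : 'cV[R[i]]_n) :
  0 <= p <= 1 -> (0 < s)%N -> (#|S| <= s)%N -> lp_cone p s S d ->
  rip_upper A (2 * s)%N alpha ->
  l2norm (A *m d) <= Num.sqrt alpha * ((1 + xi p) * l2norm d).
Proof.
move=> p01 s0 Ss cd up.
have [S1 [_ [l [S1s _ [dE ls lsum]]]]] := cone_decomposition p01 s0 Ss cd.
set h := restrict_cV (S :|: S1) d in dE.
have hl : {in h :: l, forall u, sparse (2 * s) u}.
  move=> u; rewrite inE => /orP[/eqP ->|/ls[X Xs Xu]]; last exact: supported_sparse Xu.
  apply: supported_sparse (@supported_restrict _ _ (S :|: S1) d).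
  by rewrite cardsU (leq_trans (leq_subr _ _)) // mul2n -addnn leq_add.
have := rip_norm_sum_le up hl; rewrite !big_cons -dE => /le_trans; apply.
apply: ler_wpM2l; first exact: sqrtr_ge0.
by rewrite mulrDl mul1r; apply: lerD => //; apply: l2norm_restrict_le.
Qed.

(** For the gradient point [g], expanding |(g - z) - d'|^2 <= |g - z|^2 gives |d'|^2 <= 2 <g - z,
    d'>; the adjoint then moves the gradient term to the image of [A]. *)
Lemma projection_step_le m n (A : 'M[R[i]]_(m, n)) (y : 'cV[R[i]]_m) Q P eta
    (x x' z : 'cV[R[i]]_n) :
  is_projection Q P -> Q z ->
  x' = P (x - eta%:C%C *: (adjoint A *m (A *m x - y))) ->
  l2norm (x' - z) ^+ 2 <=
    2 * (re_dot (x - z) (x' - z) - eta * re_dot (A *m (x - z)) (A *m (x' - z))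
         + eta * re_dot (y - A *m z) (A *m (x' - z))).
Proof.
set g := x - _%:C%C *: _ => projP Qz x'E; have [_ /(_ z Qz)] := projP g; rewrite -x'E.
set d' := x' - z.
have -> : g - x' = (g - z) - d' by rewrite /d' opprB addrA subrK.
have -> : re_dot (x - z) d' - eta * re_dot (A *m (x - z)) (A *m d')
    + eta * re_dot (y - A *m z) (A *m d') = re_dot (g - z) d'.
  have -> : g - z = (x - z) - eta%:C%C *: (adjoint A *m (A *m x - y)).
    by rewrite /g addrAC.
  by rewrite mulmxBr !re_dotBl re_dotZl re_dot_adjoint re_dotBl; ring.
rewrite -!re_dotxx !(re_dotBl (g - z) d', re_dotBr (g - z) d').
by rewrite (re_dotC d' (g - z)); lra.
Qed.

(** The two bounds are compared on a coordinate vector. For n = 0 every non-negative number is a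
    lower constant, contradicting the maximality of [beta]. *)
Lemma ric_lower_le_upper m n (A : 'M[R[i]]_(m, n)) r (alpha beta : R) :
  (0 < r)%N -> rip_upper A r alpha -> is_ric_lower A r beta -> beta <= alpha.
Proof.
move=> r0 [_ up] [[b0 lo] ub]; case: n A up lo ub => [|n] A up lo ub.
  have : beta + 1 <= beta.
    apply: ub; split => [|x _]; first by rewrite addr_ge0.
    by rewrite [l2norm x ^+ 2]l2norm_sqr big_ord0 mulr0 sqr_ge0.
  by rewrite gerDl ler10.
pose u : 'cV[R[i]]_n.+1 := delta_mx 0 0.
have ur : sparse r u.
  apply: (@supported_sparse _ _ [set 0]%SET); first by rewrite cards1.
  by move=> i; rewrite inE mxE => /negbTE ->.
have u0 : 0 < l2norm u ^+ 2.
  rewrite exprn_gt0 // lt_def l2norm_ge0 andbT; apply/eqP => /l2norm_eq0 /matrixP.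
  by move=> /(_ 0 0); rewrite !mxE !eqxx => /eqP; rewrite oner_eq0.
by have := le_trans (lo u ur) (up u ur); rewrite ler_pM2r.
Qed.

End DescentStep.

(* The hypothesis [l2norm (x 0%N - xstar) <= l2norm xstar] holds for the start
   [x 0%N = 0].  Without it the bound fails, since its first term does not
   depend on [x 0%N]: take k = 0, e = 0, eps = 0 and [x 0%N = - xstar]. *)
Theorem theorem2p1 (R : realType) (m n : nat) (p : R) (s : nat)
  (A : 'M[R[i]]_(m, n)) (xstar : 'cV[R[i]]_n) (e y : 'cV[R[i]]_m)
  (alpha3s beta3s alpha2s : R) (eps chat tau : R)
  (P : 'cV[R[i]]_n -> 'cV[R[i]]_n) (eta : nat -> R)
  (x : nat -> 'cV[R[i]]_n) :
  0 <= p <= 1 ->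
  (1 <= s)%N ->
  sparse s xstar ->
  y = A *m xstar + e ->
  is_ric_upper A (3 * s)%N alpha3s ->
  is_ric_lower A (3 * s)%N beta3s ->
  is_ric_upper A (2 * s)%N alpha2s ->
  0 <= eps < 1 ->
  (p = 0 -> eps = 0) ->
  chat = powR (1 - eps) p * lpnorm_pow p xstar ->
  is_projection (lpball p chat) P ->
  pgd_iterates A y (lpball p chat) P eta x ->
  l2norm (x 0%N - xstar) <= l2norm xstar ->
  (forall k, 0 < eta k) ->
  0 <= tau ->
  (forall k, `|eta k * (alpha3s + beta3s) / 2 - 1| <= tau) ->
  let rho3s := ric_ratio alpha3s beta3s in
  (1 + tau) * rho3s + tau < 1 / (2 * (1 + Num.sqrt 2 * xi p) ^+ 2) ->
  let gamma := ((1 + tau) * rho3s + tau) * (1 + Num.sqrt 2 * xi p) ^+ 2 in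
  forall k : nat,
    l2norm (x k - xstar) <=
      (2 * gamma) ^+ k * l2norm xstar
      + 2 * (1 + tau) / (1 - 2 * gamma) * (1 + xi p)
        * (eps * (1 + rho3s) * l2norm xstar
           + 2 * Num.sqrt alpha2s / (alpha3s + beta3s) * l2norm e)
      + eps * l2norm xstar.
Proof.
move=> p01 s0 xs yE [up3 _] ric_lo [up2 min2] /andP[eps0 eps1] _ chatE projP.
move=> [x0B iter] x0 eta0 tau0 htau rho3s small gamma.
have lo3 := ric_lo.1.
have s3 : (0 < 3 * s)%N by rewrite muln_gt0.
have ba := ric_lower_le_upper s3 up3 ric_lo.
have [a3 b3] := (up3.1, lo3.1).
have xi0 := xi_ge0 p.
set q := 1 + Num.sqrt 2 * xi p in small gamma *.
have q1 : 1 <= q by rewrite lerDl mulr_ge0 ?sqrtr_ge0.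
have q2 : 0 < q ^+ 2 by rewrite exprn_gt0 // (lt_le_trans _ q1).
have gamma_lt : 2 * gamma < 1.
  have q20 : 0 < 2 * q ^+ 2 by rewrite mulr_gt0.
  by move: small; rewrite (ltr_pdivlMr _ _ q20) mulrCA.
(* If the sum vanished, the step-size condition would force tau >= 1 while rho would be 0, as
   division by 0 yields 0; then gamma >= 1, against 2 gamma < 1. *)
have ab : 0 < alpha3s + beta3s.
  rewrite lt_def addr_ge0 // andbT; apply/eqP => ab.
  have tau1 : 1 <= tau by move: (htau 0%N); rewrite ab mulr0 mul0r sub0r normrN1.
  move: gamma_lt; rewrite /gamma /rho3s /ric_ratio ab invr0 !mulr0 add0r.
  have : 1 * 1 <= tau * q ^+ 2 by apply: ler_pM => //; rewrite exprn_ege1.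
  by lra.
have rho0 : 0 <= rho3s by rewrite divr_ge0 ?subr_ge0 // ltW.
have gamma0 : 0 <= 2 * gamma.
  by rewrite mulr_ge0 // mulr_ge0 ?(ltW q2) // addr_ge0 // mulr_ge0 // addr_ge0.
pose z := (1 - eps)%:C%C *: xstar.
have zx : l2norm (z - xstar) = eps * l2norm xstar.
  have -> : z - xstar = (- eps)%:C%C *: xstar.
    rewrite -[X in _ - X]scale1r -scalerBl; congr (_ *: _).
    by rewrite -(rmorph1 (real_complex R)) -rmorphB /=; congr (_%:C)%C; ring.
  by rewrite l2normZ normrN ger0_norm.
have ballE : chat = lpnorm_pow p z by rewrite chatE lpnorm_powZ // subr_gt0.
pose S := [set i | xstar i 0 != 0]%SET.
have xS : supported S xstar by move=> i; rewrite inE negbK => /eqP.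
have zS : supported S z by apply: supportedZ.
have zs : sparse s z by apply: supported_sparse zS.
have xB k : lpball p chat (x k) by case: k => [//|k]; rewrite iter; apply: (projP _).1.
have cone k : lp_cone p s S (x k - z).
  by apply: ball_sub_cone => //; rewrite -ballE; apply: xB.
have zB : lpball p chat z by rewrite /lpball /= ballE.
set c := 2 * Num.sqrt alpha2s / (alpha3s + beta3s).
set noise := eps * (1 + rho3s) * l2norm xstar + c * l2norm e.
set B := l2norm xstar in x0 zx noise *; set E := l2norm e in noise *.
have [B0 E0] : 0 <= B /\ 0 <= E by split; apply: l2norm_ge0.
have a2 : 0 <= alpha2s by apply: up2.1.
have a23 : alpha2s <= alpha3s.
  apply: min2; split=> // u us; apply: up3.2; apply: leq_trans us _.
  by rewrite leq_mul2r orbT.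
set C := 2 * (1 + tau) * (1 + xi p) * noise.
have c0 : 0 <= c * E.
  by rewrite mulr_ge0 // divr_ge0 ?(ltW ab) // mulr_ge0 ?sqrtr_ge0.
have epsB0 : 0 <= eps * B by apply: mulr_ge0.
have noise0 : eps * B <= noise.
  have := mulr_ge0 epsB0 rho0; rewrite /noise; lra.
have C0 : 0 <= C.
  by apply: mulr_ge0 (le_trans epsB0 noise0); rewrite !mulr_ge0 ?addr_ge0.
have epsC : eps * B <= C.
  apply: (le_trans noise0); apply: ler_peMl; first exact: le_trans noise0.
  by have := mulr_ge0 tau0 xi0; lra.
have step k : l2norm (x k.+1 - z) <= 2 * gamma * l2norm (x k - z) + C.
  set D := l2norm (x k - z); set D' := l2norm (x k.+1 - z).
  have D'0 : 0 <= D' by apply: l2norm_ge0.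
  have := projection_step_le projP zB (iter k); rewrite -/D'.
  have := cone_rip_dot_le p01 s0 xs (cone k) (cone k.+1) up3 lo3 ba ab (eta0 k)
    tau0 (htau k); rewrite -/D -/D' -/q -/rho3s -/gamma.
  have noise_le : eta k * re_dot (y - A *m z) (A *m (x k.+1 - z)) <=
      (1 + tau) * (1 + xi p) * noise * D'.
    have Ad := cone_rip_norm_le p01 s0 xs (cone k.+1) up2; rewrite -/D' in Ad.
    (* Shrinking the target to [z] acts as extra measurement noise eps A xstar. *)
    have wE : y - A *m z = eps%:C%C *: (A *m xstar) + e.
      have -> : A *m z = A *m xstar - eps%:C%C *: (A *m xstar).
        by rewrite -scalemxAr rmorphB rmorph1 scalerBl scale1r.
      by rewrite yE opprB addrC addrA subrK.
    have w_le : l2norm (y - A *m z) <= eps * (Num.sqrt alpha2s * B) + E.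
      rewrite wE; apply: le_trans (l2normD _ _) _.
      rewrite l2normZ (ger0_norm eps0) lerD2r; apply: ler_wpM2l => //.
      rewrite -(ler_pXn2r (n := 2)) ?nnegrE ?mulr_ge0 ?l2norm_ge0 ?sqrtr_ge0 //.
      rewrite exprMn (sqr_sqrtr a2); apply: up2.2.
      by apply: leq_trans xs _; rewrite leq_pmull.
    have dot_le : re_dot (y - A *m z) (A *m (x k.+1 - z)) <=
        (eps * (Num.sqrt alpha2s * B) + E) * (Num.sqrt alpha2s * ((1 + xi p) * D')).
      apply: le_trans (re_dot_le _ _) _.
      by apply: ler_pM => //; apply: l2norm_ge0.
    apply: le_trans (ler_wpM2l (ltW (eta0 k)) dot_le) _.
    have sqr_a2 : Num.sqrt alpha2s * Num.sqrt alpha2s = alpha2s.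
      by rewrite -expr2 sqr_sqrtr.
    have -> : eta k * ((eps * (Num.sqrt alpha2s * B) + E) *
        (Num.sqrt alpha2s * ((1 + xi p) * D'))) =
      (eps * B * (eta k * alpha2s) + eta k * Num.sqrt alpha2s * E) *
        ((1 + xi p) * D').
      by move: sqr_a2; move: (Num.sqrt alpha2s) => r <-; ring.
    have -> : (1 + tau) * (1 + xi p) * noise * D' =
      (1 + tau) * noise * ((1 + xi p) * D') by ring.
    apply: ler_wpM2r; first by rewrite mulr_ge0 // addr_ge0.
    (* The upper half of the step-size condition; with alpha2s <= alpha3s and [rhoE] it yields eta
       alpha2s <= (1 + tau)(1 + rho). *)
    have eta_le : eta k <= (1 + tau) * (2 / (alpha3s + beta3s)).
      rewrite mulrA ler_pdivlMr //.
      by have := htau k; rewrite ler_norml => /andP[_]; lra.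
    have rhoE : 1 + rho3s = 2 / (alpha3s + beta3s) * alpha3s.
      by rewrite /rho3s /ric_ratio; field; rewrite gt_eqF.
    have -> : (1 + tau) * noise = eps * B * ((1 + tau) * (1 + rho3s)) +
        (1 + tau) * (2 / (alpha3s + beta3s)) * Num.sqrt alpha2s * E.
      by rewrite /noise /c; ring.
    rewrite rhoE [_ * (_ * alpha3s)]mulrA; apply: lerD.
      apply: ler_wpM2l; first exact: mulr_ge0.
      by apply: ler_pM => //; apply: ltW.
    by rewrite !ler_wpM2r ?sqrtr_ge0.
  move=> cross; rewrite -/S => sqr_le.
  have {}sqr_le : D' ^+ 2 <= (2 * gamma * D + C) * D'.
    by move: cross noise_le sqr_le; rewrite /C; lra.
  have [->|D'n0] := eqVneq D' 0.
    rewrite addr_ge0 //; first by rewrite mulr_ge0 ?l2norm_ge0.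
  by move: sqr_le; rewrite expr2 ler_pM2r // lt_def D'n0.
(* The constant C / (1 - 2 gamma) is the fixed point of t -> 2 gamma t + C. *)
have main k : l2norm (x k - z) <= (2 * gamma) ^+ k * B + C / (1 - 2 * gamma).
  have gap : 0 < 1 - 2 * gamma by rewrite subr_gt0.
  elim: k => [|k IH].
    rewrite expr0 mul1r.
    (* Starting from [z] instead of [xstar] costs eps B, absorbed since eps B <= C <= C / (1 - 2
       gamma). *)
    have -> : x 0%N - z = (x 0%N - xstar) - (z - xstar) by rewrite opprB addrA subrK.
    apply: le_trans (l2normD _ _) _; rewrite l2normN zx; apply: lerD => //.
    apply: le_trans epsC _; rewrite ler_pdivlMr // ler_piMr //; lra.
  apply: le_trans (step k) _.
  apply: le_trans (lerD (ler_wpM2l gamma0 IH) (lexx C)) _.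
  rewrite exprS mulrDr mulrA -addrA lerD2l le_eqVlt; apply/orP; left; apply/eqP.
  by field; rewrite gt_eqF.
move=> k; have -> : x k - xstar = (x k - z) + (z - xstar) by rewrite addrA subrK.
apply: le_trans (l2normD _ _) _; rewrite zx lerD2r.
apply: le_trans (main k) _; rewrite lerD2l /C.
by rewrite le_eqVlt; apply/orP; left; apply/eqP; ring.
Qed.
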